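(* Let $M$ be a left $R$-module that is projective in $\sigma[M]$ and semiprime. Suppose that $M$ is a Goldie module and that $P_1,P_2,\dots,P_n$ are the minimal primes in $M$. Let $N_i=\mathrm{Ann}_M^r(P_i)$ for $1\le i\le n$. Then there exist uniform modules $E_1,E_2,\dots,E_n$, injective in $\sigma[M]$, and positive integers $k_1,\dots,k_n$ such that $$\widehat{M}\cong E_1^{k_1}\oplus E_2^{k_2}\oplus\cdots\oplus E_n^{k_n}$$ and $\mathrm{Ass}_M(E_i)=\{P_i\}$ for each $1\le i\le n$.
   Context: $R$ is an associative ring with unity; modules are unitary left $R$-modules. For a left $R$-module $M$, a module $X$ is $M$-generated if it is an epimorphic image of a direct sum of copies of $M$, and $\sigma[M]$ is the full subcategory of left $R$-modules isomorphic to a submodule of an $M$-generated module. $M$ is projective in $\sigma[M]$ if $\mathrm{Hom}_R(M,-)$ is exact on short exact sequences in $\sigma[M]$. A submodule $N\subseteq M$ is fully invariant if $f(N)\subseteq N$ for all $f\in \mathrm{End}_R(M)$. For submodules $K,L$ of $M$, $K_ML=\sum\{f(K)\mid f\in \mathrm{Hom}_R(M,L)\}$. A fully invariant submodule $N\neq M$ is prime in $M$ if for all fully invariant submodules $K,L$ of $M$, $K_ML\subseteq N$ implies $K\subseteq N$ or $L\subseteq N$; it is semiprime in $M$ if for every fully invariant submodule $K$ of $M$, $K_MK\subseteq N$ implies $K\subseteq N$. $M$ is a semiprime module if $0$ is semiprime in $M$ (in particular $M\ne 0$). A minimal prime in $M$ is a submodule prime in $M$ that is minimal under inclusion among the submodules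 prime in $M$; ''the minimal primes $P_1,\dots,P_n$'' means the complete list without repetition. For a submodule $N$ of $M$, $\mathrm{Ann}_M^r(N)=\sum\{L\subseteq M\mid N_ML=0\}$. For $X\in\sigma[M]$, $\mathrm{Ann}_M(X)=\bigcap\{\ker f\mid f\in \mathrm{Hom}_R(M,X)\}$. For $N\in\sigma[M]$, a proper fully invariant submodule $K$ of $M$ is associated to $N$ if there is a nonzero submodule $L$ of $N$ with $\mathrm{Ann}_M(L')=K$ for all nonzero submodules $L'$ of $L$ (such $K$ is prime in $M$); $\mathrm{Ass}_M(N)$ is the set of all submodules prime in $M$ associated to $N$. $M$ satisfies ACC on annihilators if the set $\{\bigcap_{f\in X}\ker f\mid X\subseteq \mathrm{End}_R(M)\}$ satisfies the ascending chain condition. $M$ is a Goldie module if it satisfies ACC on annihilators and has finite uniform dimension. A module is uniform if it is nonzero and any two of its nonzero submodules have nonzero intersection. $\widehat{X}$ denotes the injective hull of $X$ in $\sigma[M]$. *)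

(* Defs.v *)
From HB Require Import structures.
From mathcomp Require Import all_boot all_order all_algebra.
From mathcomp Require Import boolp classical_sets functions cardinality.

Set Implicit Arguments.
Unset Strict Implicit.
Unset Printing Implicit Defensive.

Import GRing.Theory.
Local Open Scope classical_set_scope.
Local Open Scope ring_scope.

(* Submodules are the library's [submodClosed V]: boolean predicates closed
   under the module operations.  Since every set is classically decidable, all
   submodules are of this form, and by [submod_eqP] they are equal (in the
   sense of Leibniz) as soon as they have the same elements. *)

Section Submodules.
Variables (R : pzRingType) (V : lmodType R).
Implicit Types S T : submodClosed V.

Lemma submod_eqP S T : S =i T <-> S = T.
Proof.
split=> [|-> //]; case: S T => [S [[a] [b]]] [T [[c] [d]]] eqST.
have {}eqST : S = T by apply: funext => x; exact: (eqST x).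
case: _ / eqST in c d *.
by rewrite (Prop_irrelevance a c) (Prop_irrelevance b d).
Qed.

Definition submod_of_set (A : set V)
    (closedA : submod_closed (fun x => x \in A)) : submodClosed V :=
  HB.pack (fun x => x \in A) (GRing.isSubmodClosed.Build R V _ closedA).

Definition submodule_closed (A : set V) :=
  A 0 /\ forall (a : R) x y, A x -> A y -> A (a *: x + y).

Lemma submodule_closedP (A : set V) :
  submodule_closed A -> submod_closed (fun x => x \in A).
Proof.
move=> [A0 AZD]; split=> [|a x y]; rewrite !unfold_in /=; first exact: mem_set.
by move=> /set_mem Ax /set_mem Ay; apply/mem_set/AZD.
Qed.

Definition mk_submod (A : set V) (cA : submodule_closed A) : submodClosed V :=
  submod_of_set (submodule_closedP cA).

Lemma zero_submod_subproof : submodule_closed [set 0].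
Proof. by split=> // a x y -> ->; rewrite scaler0 addr0. Qed.

Definition zero_submod := mk_submod zero_submod_subproof.

Lemma full_submod_subproof : submodule_closed [set: V].
Proof. by []. Qed.

Definition full_submod := mk_submod full_submod_subproof.

(* The sum of an arbitrary family of submodules. *)
Lemma sum_submod_subproof (F : set (submodClosed V)) :
  submodule_closed [set x | exists2 s : seq V,
    (forall y, y \in s -> exists2 L, F L & y \in L) & x = \sum_(y <- s) y].
Proof.
split=> [|a _ _ [s sF ->] [t tF ->]]; first by exists [::]; rewrite ?big_nil.
exists ([seq a *: y | y <- s] ++ t); last first.
  by rewrite big_cat big_map scaler_sumr.
move=> y; rewrite mem_cat => /orP[/mapP[z /sF[L FL Lz] ->]|/tF //].
by exists L => //; exact: rpredZ.
Qed.

Definition sum_submod (F : set (submodClosed V)) : submodClosed V :=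
  mk_submod (sum_submod_subproof F).

Definition submod_type (S : submodClosed V) : Type := {x : V | x \in S}.

Definition submod_val (S : submodClosed V) : submod_type S -> V := val.

HB.instance Definition _ (S : submodClosed V) :=
  [isSub of submod_type S for @submod_val S].
HB.instance Definition _ (S : submodClosed V) :=
  [Choice of submod_type S by <:].
HB.instance Definition _ (S : submodClosed V) :=
  [SubChoice_isSubLmodule of submod_type S by <:].

End Submodules.

Arguments zero_submod {R V}.
Arguments full_submod {R V}.

Section Image.
Variables (R : pzRingType) (U V : lmodType R).

Lemma image_submod_subproof (f : {linear U -> V}) (K : submodClosed U) :
  submodule_closed [set f x | x in [set` K]].
Proof.
split=> [|a _ _ [x Kx <-] [y Ky <-]]; first by exists 0; rewrite ?linear0 //= rpred0.
by exists (a *: x + y); rewrite ?linearP //= rpredD // rpredZ.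
Qed.

Definition image_submod (f : {linear U -> V}) (K : submodClosed U) :
  submodClosed V := mk_submod (image_submod_subproof f K).

Definition isomorphic := exists f : {linear U -> V}, bijective f.

End Image.

(* The direct product of a family of modules, and inside it the (external)
   direct sum, made of the functions of finite support. *)

Section DirectSum.
Variables (R : pzRingType) (I : Type) (V : I -> lmodType R).

Definition dirprod : Type := forall i, V i.

HB.instance Definition _ := gen_eqMixin dirprod.
HB.instance Definition _ := gen_choiceMixin dirprod.

Definition dirprod_add (f g : dirprod) : dirprod := fun i => f i + g i.
Definition dirprod_opp (f : dirprod) : dirprod := fun i => - f i.
Definition dirprod_scale (a : R) (f : dirprod) : dirprod := fun i => a *: f i.

Lemma dirprod_addA : associative dirprod_add.
Proof. by move=> f g h; apply: functional_extensionality_dep => i; exact: addrA. Qed.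
Lemma dirprod_addC : commutative dirprod_add.
Proof. by move=> f g; apply: functional_extensionality_dep => i; exact: addrC. Qed.
Lemma dirprod_add0 : left_id (fun i => 0 : V i) dirprod_add.
Proof. by move=> f; apply: functional_extensionality_dep => i; exact: add0r. Qed.
Lemma dirprod_addN : left_inverse (fun i => 0 : V i) dirprod_opp dirprod_add.
Proof. by move=> f; apply: functional_extensionality_dep => i; exact: addNr. Qed.

HB.instance Definition _ :=
  GRing.isZmodule.Build dirprod dirprod_addA dirprod_addC dirprod_add0 dirprod_addN.

Lemma dirprod_scaleA a b f :
  dirprod_scale a (dirprod_scale b f) = dirprod_scale (a * b) f.
Proof. by apply: functional_extensionality_dep => i; exact: scalerA. Qed.
Lemma dirprod_scale1 : left_id 1 dirprod_scale.
Proof. by move=> f; apply: functional_extensionality_dep => i; exact: scale1r. Qed.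
Lemma dirprod_scaleDr : right_distributive dirprod_scale +%R.
Proof. by move=> a f g; apply: functional_extensionality_dep => i; exact: scalerDr. Qed.
Lemma dirprod_scaleDl f : {morph dirprod_scale^~ f : a b / a + b}.
Proof. by move=> a b; apply: functional_extensionality_dep => i; exact: scalerDl. Qed.

HB.instance Definition _ := GRing.Zmodule_isLmodule.Build R dirprod
  dirprod_scaleA dirprod_scale1 dirprod_scaleDr dirprod_scaleDl.

Lemma fin_supp_subproof :
  submodule_closed [set f : dirprod | finite_set [set i | f i <> 0]].
Proof.
split=> [|a f g].
  by apply: (@sub_finite_set _ _ set0) => // i /=.
move=> finf fing; apply: (@sub_finite_set _ _ ([set i | f i <> 0] `|` [set i | g i <> 0])).
  move=> i /= fgi; have [fi0|] := pselect (f i = 0); last by left.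
  right=> gi0; apply: fgi; rewrite /GRing.add /= /dirprod_add.
  by rewrite /GRing.scale /= /dirprod_scale fi0 gi0 scaler0 addr0.
by rewrite finite_setU.
Qed.

Definition fin_supp : submodClosed dirprod := mk_submod fin_supp_subproof.

Definition dsum : lmodType R := submod_type fin_supp.

End DirectSum.

Section Modules.
Variables (R : pzRingType) (X : lmodType R).

Definition nonzero_submod (S : submodClosed X) := exists2 x, x \in S & x != 0.

Definition uniform_module :=
  (exists x : X, x != 0) /\
  forall S T : submodClosed X, nonzero_submod S -> nonzero_submod T ->
    exists x, [/\ x \in S, x \in T & x != 0].

Definition independent (I : Type) (N : I -> submodClosed X) :=
  forall i x, x \in N i -> x \in sum_submod [set N j | j in [set j | j <> i]] ->
    x = 0.

(* no infinite direct sum of nonzero submodules *)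
Definition finite_uniform_dimension :=
  ~ exists N : nat -> submodClosed X,
      (forall i, nonzero_submod (N i)) /\ independent N.

End Modules.

Section ShortExact.
Variables (R : pzRingType) (A B C : lmodType R).

Definition short_exact (f : {linear A -> B}) (g : {linear B -> C}) :=
  [/\ injective f,
      (forall b, g b = 0 <-> exists a, f a = b) &
      (forall c, exists b, g b = c)].

End ShortExact.

Section Relative.
Variables (R : pzRingType) (M : lmodType R).
Implicit Types K L N P Q : submodClosed M.

Definition M_generated (X : lmodType R) :=
  exists (I : Type) (f : {linear dsum (fun _ : I => M) -> X}),
    forall x, exists y, f y = x.

Definition sigma (X : lmodType R) :=
  exists Y : lmodType R, M_generated Y /\
    exists S : submodClosed Y, isomorphic X (submod_type S).

(* exactness of 0 -> Hom(M, A) -> Hom(M, B) -> Hom(M, C) -> 0 *)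
Definition projective_in_sigma :=
  forall (A B C : lmodType R) (f : {linear A -> B}) (g : {linear B -> C}),
    sigma A -> sigma B -> sigma C -> short_exact f g ->
  [/\ (forall h h' : {linear M -> A}, f \o h =1 f \o h' -> h =1 h'),
      (forall h : {linear M -> B},
         (forall m, g (h m) = 0) <->
         exists k : {linear M -> A}, f \o k =1 h) &
      (forall h : {linear M -> C}, exists k : {linear M -> B}, g \o k =1 h)].

Definition injective_in_sigma (E : lmodType R) :=
  sigma E /\
  forall (A B : lmodType R) (f : {linear A -> B}), sigma A -> sigma B ->
    injective f ->
  forall h : {linear A -> E}, exists k : {linear B -> E}, k \o f =1 h.

(* [H], with the embedding [i], is an injective hull of [M] in sigma[M]. *)
Definition injective_hull (H : lmodType R) (i : {linear M -> H}) :=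
  [/\ injective_in_sigma H, injective i &
      forall S : submodClosed H, nonzero_submod S ->
        exists2 m : M, m != 0 & i m \in S].

Definition fully_invariant N :=
  forall (f : {linear M -> M}) x, x \in N -> f x \in N.

(* K_M L *)
Definition prod_in K L : submodClosed M :=
  sum_submod [set image_submod (@submod_val R M L \o f) K |
               f in [set: {linear M -> submod_type L}]].

Definition prime_in N :=
  [/\ fully_invariant N, N <> full_submod &
      forall K L, fully_invariant K -> fully_invariant L ->
        {subset prod_in K L <= N} -> {subset K <= N} \/ {subset L <= N}].

Definition semiprime_in N :=
  [/\ fully_invariant N, N <> full_submod &
      forall K, fully_invariant K ->
        {subset prod_in K K <= N} -> {subset K <= N}].

Definition semiprime_module := semiprime_in zero_submod.

Definition minimal_prime_in P :=
  prime_in P /\ forall Q, prime_in Q -> {subset Q <= P} -> Q = P.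

(* Ann^r_M(N) *)
Definition right_annihilator N : submodClosed M :=
  sum_submod [set L | prod_in N L = zero_submod].

Lemma annihilator_subproof (X : lmodType R) :
  submodule_closed [set m : M | forall f : {linear M -> X}, f m = 0].
Proof.
split=> [f|a x y xP yP f]; first by rewrite linear0.
by rewrite linearP xP yP scaler0 addr0.
Qed.

(* Ann_M(X) *)
Definition annihilator (X : lmodType R) : submodClosed M :=
  mk_submod (annihilator_subproof X).

Definition associated (X : lmodType R) K :=
  [/\ fully_invariant K, K <> full_submod &
      exists L : submodClosed X, nonzero_submod L /\
        forall L' : submodClosed X, {subset L' <= L} -> nonzero_submod L' ->
          annihilator (submod_type L') = K].

Definition Ass (X : lmodType R) : set (submodClosed M) :=
  [set K | prime_in K /\ associated X K].

Definition endo_annihilator (X : set {linear M -> M}) : set M :=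
  [set m | forall f, X f -> f m = 0].

Definition acc_on_annihilators :=
  forall X : nat -> set {linear M -> M},
    (forall j, endo_annihilator (X j) `<=` endo_annihilator (X j.+1)) ->
  exists m, forall j, (m <= j)%N ->
    endo_annihilator (X j) = endo_annihilator (X m).

Definition goldie_module := acc_on_annihilators /\ finite_uniform_dimension M.

End Relative.

Arguments Ass {R} M X.

(* Main.v *)
Require Import Defs.
From HB Require Import structures.
From mathcomp Require Import all_boot all_order all_algebra.
From mathcomp Require Import boolp classical_sets functions cardinality.
From mathcomp Require Import finmap fsbigop.

Set Implicit Arguments.
Unset Strict Implicit.
Unset Printing Implicit Defensive.

Import GRing.Theory.
Local Open Scope classical_set_scope.
Local Open Scope ring_scope.

(** Three facts about submodules of [M] carry the proof.

    Projectivity lets maps from [M] into a sum of images of a submodule [L] be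
    lifted to a direct sum of copies of [L] ([lift_vanish]).  It follows that
    semiprimeness, postulated for fully invariant submodules, holds for all
    submodules: each nonzero [L] has a map [M -> L] that is not zero on [L]
    ([semiprime_ex]).

    Next, the chain condition on annihilators gives every nonzero submodule a
    nonzero submodule [L] all of whose nonzero submodules have the same
    annihilator [K] ([ann_stable_ex]).  Such a [K] is prime, and even a minimal
    prime: it annihilates the fully invariant closure [L_M M], which it does not
    contain, so a prime inside [K] must contain [K] ([ann_stable_minimal]).

    Finally, the chain condition makes [M] behave like a nonsingular module: for
    [L] uniform, a map [M -> L] that is not zero on [L] is injective on [L]
    ([uniform_inj]).  So two uniform submodules [L] and [L'] with the same stable
    annihilator embed in each other: neither is killed by all maps from [M] to
    the other ([uniform_embed]).

    In the hull, Zorn's lemma and injectivity separate disjoint submodules by a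
    projection ([injective_split]).  Finite uniform dimension bounds the chains
    of projections, so that the identity is a finite sum of orthogonal
    projections onto uniform submodules [U j] ([uniform_decomposition]), which
    are injective.  Each [U j] meets [M] and so contains some uniform [L j] as
    above, whose annihilator is then the only prime associated to [U j]
    ([Ass_uniform]).  When [L i] and [L j] have the same annihilator, [U i] and
    [U j] are injective hulls of isomorphic modules, hence isomorphic
    ([uniform_injective_iso]).  The annihilators of the [L j] intersect in zero
    ([inter_annihilators]), so every prime contains one of them and every
    minimal prime is one of them.  Grouping the summands by their associated
    prime gives the decomposition ([group_summands]). *)

(** * Submodules and linear maps *)

Section Basics.
Variable R : pzRingType.

Definition mk_linear (U V : lmodType R) (f : U -> V) (lf : linear f) :
  {linear U -> V} := HB.pack f (GRing.isLinear.Build R U V _ f lf).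

Lemma in_mk_submod (V : lmodType R) (A : set V) (cA : submodule_closed A) x :
  (x \in mk_submod cA) <-> A x.
Proof. by split=> [/set_mem|Ax]; last exact: mem_set. Qed.

Lemma in_image_submod (U V : lmodType R) (f : {linear U -> V}) S y :
  (y \in image_submod f S) <-> exists2 x, x \in S & f x = y.
Proof. exact: in_mk_submod. Qed.

Lemma preimage_submod_subproof (U V : lmodType R) (f : {linear U -> V})
  (S : submodClosed V) : submodule_closed [set x | f x \in S].
Proof.
split=> [|a x y /= Sx Sy]; first by rewrite /= linear0 rpred0.
by rewrite linearP rpredD // rpredZ.
Qed.

Definition preimage_submod (U V : lmodType R) (f : {linear U -> V})
  (S : submodClosed V) : submodClosed U :=
  mk_submod (preimage_submod_subproof f S).

Lemma in_preimage_submod (U V : lmodType R) (f : {linear U -> V})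
  (S : submodClosed V) x : (x \in preimage_submod f S) <-> f x \in S.
Proof. exact: in_mk_submod. Qed.

Lemma cyclic_subproof (V : lmodType R) (x : V) :
  submodule_closed [set a *: x | a in [set: R]].
Proof.
split=> [|a _ _ [b _ <-] [c _ <-]]; first by exists 0; rewrite ?scale0r.
by exists (a * b + c); rewrite // scalerDl scalerA.
Qed.

Definition cyclic_submod (V : lmodType R) (x : V) : submodClosed V :=
  mk_submod (cyclic_subproof x).

Lemma in_cyclic_submod (V : lmodType R) (x y : V) :
  (y \in cyclic_submod x) <-> exists a, y = a *: x.
Proof.
split=> [/in_mk_submod[a _ <-]|[a ->]]; first by exists a.
by apply/in_mk_submod; exists a.
Qed.

Lemma cyclic_submod_id (V : lmodType R) (x : V) : x \in cyclic_submod x.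
Proof. by apply/in_cyclic_submod; exists 1; rewrite scale1r. Qed.

Lemma full_submodT (V : lmodType R) (x : V) : x \in @full_submod R V.
Proof. exact/in_mk_submod. Qed.

Lemma in_zero_submod (V : lmodType R) (x : V) :
  (x \in @zero_submod R V) <-> x = 0.
Proof. exact: in_mk_submod. Qed.

Lemma submod_subP (V : lmodType R) (S T : submodClosed V) :
  {subset S <= T} -> {subset T <= S} -> S = T.
Proof. by move=> ST TS; apply/submod_eqP => x; apply/idP/idP => [/ST|/TS]. Qed.

Lemma sum_submod_le (V : lmodType R) (F : set (submodClosed V))
  (S : submodClosed V) :
  (forall L, F L -> {subset L <= S}) -> {subset sum_submod F <= S}.
Proof.
move=> FS x /in_mk_submod[s sF ->]; rewrite big_seq; apply: rpred_sum => y /sF.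
by case=> L /FS; exact.
Qed.

Lemma sum_submod_ge (V : lmodType R) (F : set (submodClosed V)) L :
  F L -> {subset L <= sum_submod F}.
Proof.
move=> FL x Lx; apply/in_mk_submod; exists [:: x]; last by rewrite big_seq1.
by move=> y; rewrite inE => /eqP ->; exists L.
Qed.

Lemma submod_val_in (V : lmodType R) (S : submodClosed V) (x : submod_type S) :
  val x \in S.
Proof. exact: valP. Qed.

Lemma submod_val_linear (V : lmodType R) (S : submodClosed V) :
  linear (val : submod_type S -> V).
Proof. by move=> a x y; rewrite linearP. Qed.

Definition submod_incl (V : lmodType R) (S : submodClosed V) :
  {linear submod_type S -> V} := mk_linear (@submod_val_linear V S).

Lemma submod_incl_inj (V : lmodType R) (S : submodClosed V) :
  injective (@submod_incl V S).
Proof. exact: val_inj. Qed.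

Lemma corestr_subproof (U V : lmodType R) (f : {linear U -> V})
    (S : submodClosed V) (fS : forall x, f x \in S) :
  linear (fun x => exist _ (f x) (fS x) : submod_type S).
Proof.
move=> a x y; apply: val_inj; rewrite (@submod_val_linear V S a).
exact: (linearP f a x y).
Qed.

Definition corestr (U V : lmodType R) (f : {linear U -> V})
    (S : submodClosed V) (fS : forall x, f x \in S) :
  {linear U -> submod_type S} := mk_linear (corestr_subproof fS).

Lemma lin_inj (U V : lmodType R) (f : {linear U -> V}) :
  (forall x, f x = 0 -> x = 0) -> injective f.
Proof.
move=> f0 x y fxy; apply/eqP; rewrite -subr_eq0; apply/eqP/f0.
by rewrite linearB fxy subrr.
Qed.

Lemma lin_inj0 (U V : lmodType R) (f : {linear U -> V}) x :
  injective f -> f x = 0 -> x = 0.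
Proof. by move=> fI fx0; apply: fI; rewrite linear0. Qed.

Lemma factor_inj (U V W : lmodType R) (i : {linear V -> W})
    (f : {linear U -> W}) (S : submodClosed V) :
    injective i -> (forall x, exists2 y, y \in S & f x = i y) ->
  exists g : {linear U -> submod_type S}, forall x, f x = i (val (g x)).
Proof.
move=> iI fi; have /choice[g gP] x : exists y : submod_type S, f x = i (val y).
  by have [y Sy ->] := fi x; exists (exist _ y Sy).
have lg : linear g.
  move=> a x y; apply/val_inj/iI; rewrite -gP (@submod_val_linear V S a (g x)).
  by rewrite !linearP -!gP.
by exists (mk_linear lg).
Qed.

Lemma bij_inj_surj (T U : Type) (f : T -> U) :
  injective f -> (forall y, exists x, f x = y) -> bijective f.
Proof.
move=> fI /choice[g gK]; exists g => // x; exact/fI/gK.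
Qed.

Lemma dsum_coord_subproof (J : Type) (V : J -> lmodType R) j :
  linear (fun b : dsum V => submod_val b j).
Proof. by move=> a b c; rewrite (@submod_val_linear _ _ a). Qed.

Definition dsum_coord (J : Type) (V : J -> lmodType R) j :
  {linear dsum V -> V j} := mk_linear (@dsum_coord_subproof J V j).

(** Linearity is proved by merging the supports of two elements, so the value at
    [b] is described along every list that contains the support of [b], and not
    only along the support itself. *)
Lemma dsum_universal (J : choiceType) (V : J -> lmodType R) (X : lmodType R)
    (g : forall j, {linear V j -> X}) :
  exists s : {linear dsum V -> X}, forall (b : dsum V) (r : seq J), uniq r ->
    (forall j, j \notin r -> submod_val b j = 0) ->
  s b = \sum_(j <- r) g j (submod_val b j).
Proof.
pose s0 (b : dsum V) : X := \sum_(j \in [set: J]) g j (submod_val b j).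
have s0E (b : dsum V) r : uniq r ->
    (forall j, j \notin r -> submod_val b j = 0) ->
    s0 b = \sum_(j <- r) g j (submod_val b j).
  move=> ur br; rewrite /s0 (fsbigE r) //.
    by apply: eq_bigl => j; rewrite in_setT.
  by move=> j _ /br ->; rewrite linear0.
have supp (b : dsum V) : exists r : seq J,
    forall j, j \notin r -> submod_val b j = 0.
  have /in_mk_submod/finite_fsetP[r bE] := submod_val_in b; exists r => j.
  apply: contraNeq => /eqP bj.
  by have : [set` r] j by rewrite -bE.
have ls0 : linear s0.
  move=> a b c; have [rb br] := supp b; have [rc cr] := supp c.
  pose r := undup (rb ++ rc).
  have ur : uniq r by exact: undup_uniq.
  have rP j : j \notin r -> submod_val b j = 0 /\ submod_val c j = 0.
    by rewrite mem_undup mem_cat => /norP[/br ? /cr].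
  rewrite (s0E b r) //; last by move=> j /rP[].
  rewrite (s0E c r) //; last by move=> j /rP[].
  rewrite (s0E _ r) //; last first.
    move=> j /rP[bj cj].
    by rewrite (@dsum_coord_subproof _ _ j a) bj cj scaler0 addr0.
  rewrite scaler_sumr -big_split; apply: eq_bigr => j _ /=.
  by rewrite (@dsum_coord_subproof _ _ j a) linearP.
by exists (mk_linear ls0).
Qed.

Lemma dsum_delta_subproof (J : choiceType) (V : lmodType R) (j : J) (x : V) :
  (fun i => if i == j then x else 0 : V) \in fin_supp (fun _ : J => V).
Proof.
apply/(in_mk_submod (fin_supp_subproof _)); apply: sub_finite_set (finite_set1 j).
by move=> i /=; case: eqP.
Qed.

Definition dsum_delta (J : choiceType) (V : lmodType R) (j : J) (x : V) :
  dsum (fun _ : J => V) :=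
  exist (fun b => b \in fin_supp _) _ (dsum_delta_subproof j x).

Lemma dsum_deltaE (J : choiceType) (V : lmodType R) (i j : J) (x : V) :
  submod_val (dsum_delta j x) i = if i == j then x else 0.
Proof. by []. Qed.

End Basics.

(** * The category sigma[M], products and annihilators *)

Section Sigma.
Variables (R : pzRingType) (M : lmodType R).

Lemma sigma_of_inj (Y Z : lmodType R) (f : {linear Y -> Z}) :
  M_generated M Z -> injective f -> sigma M Y.
Proof.
move=> gZ fI; exists Z; split=> //; exists (image_submod f full_submod).
have fS x : f x \in image_submod f full_submod.
  by apply/in_image_submod; exists x => //; exact: full_submodT.
exists (corestr fS); apply: bij_inj_surj.
  by move=> x y /(congr1 (@submod_val _ _ _)); exact: fI.
by case=> y Sy; have /in_image_submod[x _ fxy] := Sy; exists x; exact: val_inj.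
Qed.

Lemma sigma_inj (X Y : lmodType R) (f : {linear Y -> X}) :
  sigma M X -> injective f -> sigma M Y.
Proof.
case=> Z [gZ [S [phi phi_bij]]] fI.
apply: (@sigma_of_inj Y Z (submod_incl S \o (phi \o f))) => //.
apply: inj_comp; first exact: submod_incl_inj.
exact: inj_comp (bij_inj phi_bij) fI.
Qed.

Lemma sigma_submod (X : lmodType R) (S : submodClosed X) :
  sigma M X -> sigma M (submod_type S).
Proof. by move=> sX; exact: sigma_inj sX (@submod_incl_inj R X S). Qed.

Lemma sigma_dsum (I : Type) : sigma M (dsum (fun _ : I => M)).
Proof.
apply: (@sigma_of_inj _ _ idfun) => //.
by exists I, idfun => x; exists x.
Qed.

Lemma sigma_self : sigma M M.
Proof.
apply: (@sigma_of_inj _ _ idfun) => //.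
exists unit, (@dsum_coord R _ (fun _ => M) tt) => x.
by exists (dsum_delta tt x).
Qed.

Lemma prod_inP (K L N : submodClosed M) :
  {subset prod_in K L <= N} <->
  forall f : {linear M -> M}, (forall x, f x \in L) ->
  forall x, x \in K -> f x \in N.
Proof.
split=> [KLN f fL x Kx|KLN].
  apply: KLN; apply: (@sum_submod_ge _ _ _
    (image_submod (@submod_val _ _ L \o corestr fL) K)).
    by exists (corestr fL).
  by apply/in_image_submod; exists x.
apply: sum_submod_le => _ [f _ <-] _ /in_image_submod[x Kx <-].
apply: (KLN (@submod_val _ _ L \o f)) => // y; exact: submod_val_in.
Qed.

(** Only the image of [S] under an embedding matters for its annihilator;
    this allows one to compare submodules of different modules. *)
Lemma annihilatorP (V W : lmodType R) (i : {linear V -> W})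
    (S : submodClosed V) m : injective i ->
  (m \in annihilator M (submod_type S)) <->
  forall f : {linear M -> W}, (forall x, exists2 y, y \in S & f x = i y) ->
    f m = 0.
Proof.
move=> iI; split=> [/in_mk_submod mS f fS|mS].
  by have [g ->] := factor_inj iI fS; rewrite mS linear0.
apply/in_mk_submod => f; apply: val_inj; apply: iI; rewrite [in RHS]linear0.
apply: (mS (i \o (submod_incl S \o f))) => x; exists (val (f x)) => //.
exact: submod_val_in.
Qed.

Lemma in_annihilator (V : lmodType R) (S : submodClosed V) m :
  (m \in annihilator M (submod_type S)) <->
  forall f : {linear M -> V}, (forall x, f x \in S) -> f m = 0.
Proof.
rewrite (@annihilatorP _ _ idfun)//; split=> mS f fS; apply: mS => x.
  by exists (f x); first exact: fS.
by have [y Sy ->] := fS x.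
Qed.

Lemma annihilator_le (V : lmodType R) (S T : submodClosed V) :
  {subset S <= T} ->
  {subset annihilator M (submod_type T) <= annihilator M (submod_type S)}.
Proof.
move=> ST m /in_annihilator mT; apply/in_annihilator => f fS.
by apply: mT => x; exact/ST/fS.
Qed.

Lemma annihilator_transfer (U V W : lmodType R) (i : {linear U -> W})
    (j : {linear V -> W}) (S : submodClosed U) (T : submodClosed V) :
    injective i -> injective j ->
    (forall x, x \in S -> exists2 y, y \in T & i x = j y) ->
    (forall y, y \in T -> exists2 x, x \in S & j y = i x) ->
  annihilator M (submod_type S) = annihilator M (submod_type T).
Proof.
move=> iI jI ST TS; apply: submod_subP => m.
  move=> /(annihilatorP _ _ iI) mS; apply/(annihilatorP _ _ jI) => f fT.
  by apply: mS => x; have [y /TS[z Sz ->] ->] := fT x; exists z.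
move=> /(annihilatorP _ _ jI) mT; apply/(annihilatorP _ _ iI) => f fS.
by apply: mT => x; have [y /ST[z Tz ->] ->] := fS x; exists z.
Qed.

Lemma annihilator_fi (X : lmodType R) : fully_invariant (annihilator M X).
Proof.
move=> f x /in_mk_submod xX; apply/in_mk_submod => g.
exact: (xX (g \o f)).
Qed.

(** This is how projectivity enters the proof: a map from [M] to the sum of the
    submodules [g j (L)] lifts to the direct sum of copies of [L] indexed by
    the [j], so it vanishes wherever all composites [g j \o h'], with
    [h' : M -> L], do.  It replaces the associativity of the product of
    submodules. *)
Lemma lift_vanish (projM : projective_in_sigma M) (J : choiceType)
    (g : J -> {linear M -> M}) (L : submodClosed M) (h : {linear M -> M}) m :
    (forall x,
      h x \in sum_submod (range (fun j => image_submod (g j) L))) ->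
    (forall j (k : {linear M -> M}), (forall x, k x \in L) -> g j (k m) = 0) ->
  h m = 0.
Proof.
set T := sum_submod _ => hT gk0.
have [s sE] := dsum_universal g.
have cB : submodule_closed
    [set b : dsum (fun _ : J => M) | forall j, submod_val b j \in L].
  split=> [j|a b c bL cL j]; first exact: rpred0.
  by rewrite (@dsum_coord_subproof _ _ _ j a) rpredD // rpredZ.
pose B := mk_submod cB.
have sum_dsum (b : dsum (fun _ : J => M)) :
    exists r : seq J, s b = \sum_(j <- r) g j (submod_val b j).
  have /in_mk_submod/finite_fsetP[r bE] := submod_val_in b; exists r.
  apply: sE; first exact: fset_uniq.
  move=> j; apply: contraNeq => /eqP bj; by have : [set` r] j by rewrite -bE.
have sT (b : submod_type B) : (s \o submod_incl B) b \in T.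
  have [r rE] := sum_dsum (submod_val b).
  rewrite [(s \o _) b]rE; apply: rpred_sum => j _.
  apply: (@sum_submod_ge _ _ _ (image_submod (g j) L)); first by exists j.
  apply/in_image_submod; exists (submod_val (submod_val b) j) => //.
  by have /in_mk_submod := submod_val_in b.
pose sB := corestr sT; pose A := preimage_submod sB zero_submod.
have exact_s : short_exact (submod_incl A) sB.
  split=> [|b|[t Tt]]; first exact: submod_incl_inj.
    split=> [sb0|[a <-]]; last first.
      by have /in_preimage_submod/in_zero_submod := submod_val_in a.
    have Ab : b \in A by apply/in_preimage_submod/in_zero_submod.
    by exists (exist _ b Ab).
  (* the image of [s] on [B] is a submodule containing each [g j (L)] *)
  suff /(_ t Tt)/in_image_submod[b Bb sbt] :
      {subset T <= image_submod s B}.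
    by exists (exist _ b Bb); exact: val_inj.
  apply: sum_submod_le => _ [j _ <-] _ /in_image_submod[l Ll <-].
  apply/in_image_submod; exists (dsum_delta j l).
    apply/(in_mk_submod cB) => i; rewrite dsum_deltaE.
    by case: eqP => // _; exact: rpred0.
  rewrite (sE _ [:: j]) //=; first by rewrite big_seq1 dsum_deltaE eqxx.
  by move=> i; rewrite inE dsum_deltaE => /negPf ->.
have sigB : sigma M (submod_type B) by exact/sigma_submod/sigma_dsum.
have [_ _ /(_ (corestr hT))[k kE]] := projM _ _ _ _ _
  (sigma_submod A sigB) sigB (sigma_submod T sigma_self) exact_s.
have <- : s (submod_val (k m)) = h m.
  exact: (congr1 (@submod_incl R M T) (kE m)).
have [r ->] := sum_dsum (submod_val (k m)); apply: big1 => j _.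
apply: (gk0 j (@dsum_coord R J (fun _ => M) j \o (submod_incl B \o k))) => x /=.
by have /in_mk_submod := submod_val_in (k x).
Qed.

End Sigma.

(** * Semiprime modules *)

Section Semiprime.
Variables (R : pzRingType) (M : lmodType R).
Hypotheses (projM : projective_in_sigma M) (spM : semiprime_module M).

Lemma lift_vanish1 (f : {linear M -> M}) (L : submodClosed M)
    (h : {linear M -> M}) m :
    (forall x, exists2 y, y \in L & h x = f y) ->
    (forall k : {linear M -> M}, (forall x, k x \in L) -> f (k m) = 0) ->
  h m = 0.
Proof.
move=> hf fk0; apply: (lift_vanish projM (g := fun _ : unit => f) (L := L)) => //.
move=> x; apply: (@sum_submod_ge _ _ _ (image_submod f L)); first by exists tt.
by have [y Ly ->] := hf x; apply/in_image_submod; exists y.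
Qed.

(** This is the product [L_M M], the smallest fully invariant submodule
    containing [L]. *)
Definition fi_closure (L : submodClosed M) : submodClosed M :=
  sum_submod (range (fun f : {classic {linear M -> M}} =>
    image_submod (f : {linear M -> M}) L)).

Lemma in_fi_closure (L : submodClosed M) (f : {linear M -> M}) x :
  x \in L -> f x \in fi_closure L.
Proof.
move=> Lx; apply: (@sum_submod_ge _ _ _ (image_submod f L)); first by exists f.
by apply/in_image_submod; exists x.
Qed.

Lemma fi_closure_ge (L : submodClosed M) : {subset L <= fi_closure L}.
Proof. by move=> x; exact: (@in_fi_closure L idfun). Qed.

Lemma fi_closure_fi (L : submodClosed M) : fully_invariant (fi_closure L).
Proof.
move=> f; suff fcl : {subset fi_closure L <= preimage_submod f (fi_closure L)}.
  by move=> x /fcl/in_preimage_submod.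
apply: sum_submod_le => _ [g _ <-] _ /in_image_submod[x Lx <-].
apply/in_preimage_submod; exact: (@in_fi_closure L (f \o (g : {linear _ -> _}))).
Qed.

Lemma fi_closure_vanish (L : submodClosed M) (h : {linear M -> M}) m :
    (forall x, h x \in fi_closure L) ->
    (forall k : {linear M -> M}, (forall x, k x \in L) -> k m = 0) ->
  h m = 0.
Proof.
move=> hL k0; apply: (lift_vanish projM hL) => g k kL.
by rewrite k0 // linear0.
Qed.

(** Semiprimeness only speaks of fully invariant submodules; it extends to all
    submodules [L] because [L_M L = 0] forces the square of [L_M M] to vanish. *)
Lemma semiprime_ex (L : submodClosed M) : nonzero_submod L ->
  exists f : {linear M -> M}, (forall x, f x \in L) /\
    exists2 x, x \in L & f x != 0.
Proof.
case=> x0 Lx0 /eqP x0_neq0; apply: contrapT => /forallNP fL0.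
have {}fL0 (f : {linear M -> M}) : (forall x, f x \in L) ->
    forall x, x \in L -> f x = 0.
  move=> fL x Lx; apply: contra_notP (fL0 f) => /eqP fx0.
  by split=> //; exists x.
have [_ _ /(_ _ (@fi_closure_fi L)) sp] := spM.
apply/x0_neq0/in_zero_submod; apply: sp (fi_closure_ge Lx0).
apply/prod_inP => h hL.
suff hcl : {subset fi_closure L <= preimage_submod h zero_submod}.
  by move=> x /hcl/in_preimage_submod.
apply: sum_submod_le => _ [g _ <-] _ /in_image_submod[x Lx <-].
apply/in_preimage_submod/in_zero_submod; apply: (fi_closure_vanish hL) => k kL.
by apply: (fL0 (k \o (g : {linear _ -> _}))) Lx => y; exact: kL.
Qed.

(** The submodule [L] is a witness that [K] is associated to [V]. *)
Definition ann_stable (V : lmodType R) (L : submodClosed V) K :=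
  nonzero_submod L /\
  forall L' : submodClosed V, {subset L' <= L} -> nonzero_submod L' ->
    annihilator M (submod_type L') = K.

Lemma ann_stableE (V : lmodType R) (L : submodClosed V) K :
  ann_stable L K -> annihilator M (submod_type L) = K.
Proof. by case=> L0; exact. Qed.

Lemma ann_stable_le (V : lmodType R) (L L' : submodClosed V) K :
  {subset L' <= L} -> nonzero_submod L' -> ann_stable L K -> ann_stable L' K.
Proof.
by move=> L'L L'0 [_ LK]; split=> // T TL'; apply: LK => x /TL'/L'L.
Qed.

Lemma ann_stable_fi (V : lmodType R) (L : submodClosed V) K :
  ann_stable L K -> fully_invariant K.
Proof. by move=> /ann_stableE <-; exact: annihilator_fi. Qed.

Lemma notin_annihilator (V : lmodType R) (L : submodClosed V) m :
  m \notin annihilator M (submod_type L) ->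
  exists2 f : {linear M -> V}, (forall x, f x \in L) & f m != 0.
Proof.
move=> /negP mL; apply: contra_notP mL => mL; apply/in_annihilator => f fL.
by apply: contra_notP mL => /eqP fm0; exists f.
Qed.

Lemma ann_stable_notin (L : submodClosed M) K :
  ann_stable L K -> exists2 x, x \in L & x \notin K.
Proof.
move=> sL; have [f [fL [x Lx fx0]]] := semiprime_ex sL.1.
exists x => //; apply: contra fx0; rewrite -(ann_stableE sL).
by move=> /in_annihilator ->.
Qed.

Lemma ann_stable_proper (L : submodClosed M) K :
  ann_stable L K -> K <> full_submod.
Proof.
by move=> /ann_stable_notin[x _ /negP Kx] KT; apply: Kx; rewrite KT full_submodT.
Qed.

(** If [B] is not killed by some [g : M -> L], then [g(B)] is a nonzero submodule of
    [L], and the annihilator of [g(B)] contains every [A] with [A_M B] inside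
    the annihilator of [L]. *)
Lemma ann_stable_prime (L : submodClosed M) K : ann_stable L K -> prime_in K.
Proof.
move=> sL; split; [exact: ann_stable_fi sL|exact: ann_stable_proper sL|].
move=> A B fiA fiB /prod_inP ABK; have [BK|/existsNP[b /not_implyP[Bb /negP Kb]]] :=
  pselect {subset B <= K}; [by right|left=> a Aa].
move: Kb; rewrite -(ann_stableE sL) => /notin_annihilator[g gL gb0].
rewrite (ann_stableE sL) -(proj2 sL (image_submod g B)).
- apply/in_annihilator => h hgB; apply: (lift_vanish1 (f := g) (L := B)) => [x|k kB].
    by have /in_image_submod[y By <-] := hgB x; exists y.
  have := ABK k kB a Aa; rewrite -(ann_stableE sL) => /in_annihilator.
  exact.
- by move=> _ /in_image_submod[x _ <-].
by exists (g b) => //; apply/in_image_submod; exists b.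
Qed.

(** [K] annihilates [L_M M], which is not contained in [K]. *)
Lemma ann_stable_minimal (L : submodClosed M) K :
  ann_stable L K -> minimal_prime_in K.
Proof.
move=> sL; split; first exact: ann_stable_prime sL.
move=> Q [fiQ Qproper Qprime] QK; apply: submod_subP => // x Kx.
have [x0 Lx0 /negP Kx0] := ann_stable_notin sL.
have [|//||KQ|LQ] := Qprime K (fi_closure L); first exact: ann_stable_fi sL.
- exact: fi_closure_fi.
- apply/prod_inP => f fL y Ky; suff -> : f y = 0 by exact: rpred0.
  apply: (fi_closure_vanish fL) => k kL.
  by move: Ky; rewrite -(ann_stableE sL) => /in_annihilator ->.
- exact: KQ.
by case: Kx0; exact/QK/LQ/fi_closure_ge.
Qed.

(** A prime containing a finite intersection of fully invariant submodules
    contains one of them, because [B_M A] lies in both [A] and [B]. *)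
Lemma prime_finite_inter (P : submodClosed M) (Q : nat -> submodClosed M) m :
    prime_in P -> (forall j, (j < m)%N -> fully_invariant (Q j)) ->
    (forall x, (forall j, (j < m)%N -> x \in Q j) -> x \in P) ->
  exists2 j, (j < m)%N & {subset Q j <= P}.
Proof.
move=> [_ Pproper Pprime]; elim: m => [_|m IHm fiQ] QP.
  by case: Pproper; apply: submod_subP => x _; [exact: full_submodT|exact: QP].
have cB : submodule_closed [set x | forall j, (j < m)%N -> x \in Q j].
  split=> [j _|a x y xQ yQ j jm]; first exact: rpred0.
  by rewrite rpredD ?rpredZ ?xQ ?yQ.
have [|||BP|QmP] := Pprime (mk_submod cB) (Q m).
- move=> f x /in_mk_submod xQ; apply/in_mk_submod => j jm.
  by apply: (fiQ j (leqW jm)); exact: xQ.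
- by apply: fiQ.
- apply/prod_inP => f fQ x /in_mk_submod xQ; apply: QP => j.
  rewrite ltnS leq_eqVlt => /predU1P[-> //|jm].
  by apply: (fiQ j (leqW jm)); exact: xQ.
- have [j jm|x xQ|j jm QjP] := IHm; first exact/fiQ/ltnW.
    exact/BP/in_mk_submod.
  by exists j => //; exact: ltnW.
by exists m.
Qed.

End Semiprime.

(** * Uniform submodules and chain conditions *)

Section Uniform.
Variables (R : pzRingType).

(** It is enough that nonzero cyclic submodules of [S] meet. *)
Definition uniform_submod (V : lmodType R) (S : submodClosed V) :=
  nonzero_submod S /\
  forall x y, x \in S -> y \in S -> x != 0 -> y != 0 ->
    exists a b : R, a *: x = b *: y /\ a *: x != 0.

Lemma uniform_submod_le (V : lmodType R) (S T : submodClosed V) :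
  {subset T <= S} -> nonzero_submod T -> uniform_submod S -> uniform_submod T.
Proof. by move=> TS T0 [_ unifS]; split=> // x y /TS Sx /TS; exact: unifS. Qed.

Variable (M : lmodType R).
Hypotheses (projM : projective_in_sigma M) (spM : semiprime_module M).
Hypothesis (accM : acc_on_annihilators M).

Lemma acc_maximal (F : set (set {linear M -> M})) X0 : F X0 ->
  exists2 X, F X & forall Y, F Y ->
    endo_annihilator X `<=` endo_annihilator Y ->
    endo_annihilator Y `<=` endo_annihilator X.
Proof.
move=> FX0; apply: contrapT => noMax.
have step (X : {X | F X}) : exists Y : {X | F X},
    endo_annihilator (sval X) `<=` endo_annihilator (sval Y) /\
    ~ (endo_annihilator (sval Y) `<=` endo_annihilator (sval X)).
  case: X => X FX /=; apply: contra_notP noMax => noY; exists X => // Y FY XY.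
  by apply: contra_notP noY => YX; exists (exist _ Y FY).
have [next nextP] := choice step.
pose X n := sval (iter n next (exist _ X0 FX0)).
have [m mP] := accM (X := X) (fun j => (nextP (iter j next _)).1).
have [_] := nextP (iter m next (exist _ X0 FX0)); apply.
by rewrite -[X in X `<=` _]/(endo_annihilator (X m.+1)) mP.
Qed.

(** Annihilators grow when submodules shrink, so a nonzero submodule with a
    maximal annihilator shares it with all its nonzero submodules. *)
Lemma ann_stable_ex (U : submodClosed M) : nonzero_submod U ->
  exists (L K : submodClosed M), {subset L <= U} /\ ann_stable L K.
Proof.
move=> U0; pose into (L : submodClosed M) :=
  [set f : {linear M -> M} | forall x, f x \in L].
have intoP (L : submodClosed M) m :
    endo_annihilator (into L) m <-> m \in annihilator M (submod_type L).
  split=> [mL|/in_annihilator mL f]; last exact: mL.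
  by apply/in_annihilator => f; exact: mL.
have [|_ [L [LU L0] <-] Lmax] := @acc_maximal
  [set into L | L in
    [set L : submodClosed M | {subset L <= U} /\ nonzero_submod L]] (into U).
  by exists U => //; split.
exists L, (annihilator M (submod_type L)); split=> //; split=> // L' L'L L'0.
apply: submod_subP; last exact: annihilator_le.
move=> m /intoP mL'; apply/intoP; apply: Lmax mL'.
  by exists L' => //; split=> // x /L'L/LU.
by move=> x /intoP xL; apply/intoP; exact: annihilator_le xL.
Qed.

(** A form of nonsingularity.  If it fails, then among the maps [f : M -> L] that
    are neither zero nor injective on [L] the chain condition provides one with
    a maximal kernel.  For [h : M -> L], uniformity makes the kernel of
    [f \o h \o f] strictly larger, so that [f \o h \o f] is zero on [L];
    lifting along [f : L -> f(L)], the submodule [f(L)] has zero square. *)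
Lemma uniform_inj (L : submodClosed M) (f : {linear M -> M}) x z :
    uniform_submod L -> (forall y, f y \in L) -> x \in L -> f x != 0 ->
  z \in L -> f z = 0 -> z = 0.
Proof.
move=> [_ unifL] fL Lx fx0 Lz fz0; apply/eqP; apply: contraT => z0.
pose bad (f : {linear M -> M}) := [/\ (forall y, f y \in L),
  (exists2 x, x \in L & f x != 0) & (exists2 z, z \in L & z != 0 /\ f z = 0)].
have : bad f by split=> //; [exists x|exists z].
move: f {x z fL Lx fx0 Lz z0 fz0} => f0 bad0.
have [|_ [f [fL [x Lx fx0] [z Lz [z0 fz0]]] <-] fmax] := @acc_maximal
  [set [set f] | f in [set f : {linear M -> M} | bad f]] [set f0].
  by exists f0.
have fhf0 (h : {linear M -> M}) : (forall y, h y \in L) ->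
    forall y, y \in L -> f (h (f y)) = 0.
  move=> hL y Ly; apply/eqP; apply: contraT => fhfy0.
  have [w Lw [w0 fhw0]] : exists2 w, w \in L & w != 0 /\ f (h w) = 0.
    have [hz0|hz0] := eqVneq (h z) 0; first by exists z; rewrite // hz0 linear0.
    have [a [b [ab abz0]]] := unifL _ _ (hL z) Lz hz0 z0.
    exists (a *: z); first exact: rpredZ.
    split; last by rewrite linearZ /= ab linearZ /= fz0 scaler0.
    by apply: contraNneq abz0 => az0; rewrite -linearZ /= az0 linear0.
  have [a [b [ab abx0]]] := unifL _ _ (fL x) Lw fx0 w0.
  have : endo_annihilator [set f \o (h \o f) : {linear M -> M}] `<=`
      endo_annihilator [set f].
    apply: fmax; last by move=> u fu g -> /=; rewrite (fu f) // !linear0.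
    exists (f \o (h \o f)) => //; split=> [u /=|| ]; first exact: fL.
      by exists y.
    by exists z => //; split=> //=; rewrite fz0 !linear0.
  move=> /(_ (a *: x)); rewrite /endo_annihilator /= => /(_ _ f erefl) fax0.
  case/negP: abx0; rewrite -linearZ /= fax0 // => g -> /=.
  by rewrite linearZ /= ab !linearZ /= fhw0 scaler0.
have [|g [gfL [_ /in_image_submod[y Ly <-] /eqP]]] :=
  semiprime_ex projM spM (L := image_submod f L).
  by exists (f x) => //; apply/in_image_submod; exists x.
case; apply: (lift_vanish1 projM (f := f) (L := L)) => [u|k kL]; last exact: fhf0.
by have /in_image_submod[v Lv <-] := gfL u; exists v.
Qed.

(** Maps [g : M -> L'] and [h : M -> L] with [h \o g] nonzero on [L] exist
    because [L] and [L'] have the same annihilator; then [h \o g], hence [g],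
    is injective on [L]. *)
Lemma uniform_embed (L L' K : submodClosed M) :
    uniform_submod L -> ann_stable L K -> ann_stable L' K ->
  exists2 g : {linear M -> M}, (forall x, g x \in L') &
    forall z, z \in L -> g z = 0 -> z = 0.
Proof.
move=> unifL sL sL'; have [x Lx] := ann_stable_notin projM spM sL.
rewrite -(ann_stableE sL') => /notin_annihilator[g gL' gx0].
have : ann_stable (image_submod g L) K.
  apply: ann_stable_le sL' => [_ /in_image_submod[y _ <-] //|].
  by exists (g x) => //; apply/in_image_submod; exists x.
move=> /(ann_stable_notin projM spM)[_ /in_image_submod[y Ly <-]].
rewrite -(ann_stableE sL) => /notin_annihilator[h hL hgy0].
exists g => // z Lz gz0.
apply: (uniform_inj (f := h \o g) unifL _ Ly) => //=.
by rewrite gz0 linear0.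
Qed.

End Uniform.

(** * Splitting injective modules *)

Section Splitting.
Variable R : pzRingType.

Definition disjoint_submod (V : lmodType R) (S T : submodClosed V) :=
  forall x, x \in S -> x \in T -> x = 0.

Lemma complement_ex (V : lmodType R) (S T : submodClosed V) :
    disjoint_submod S T ->
  exists T' : submodClosed V, [/\ {subset T <= T'}, disjoint_submod S T' &
    forall T'' : submodClosed V, {subset T' <= T''} -> disjoint_submod S T'' ->
      {subset T'' <= T'}].
Proof.
move=> disjST.
pose good (A : set V) := [/\ submodule_closed A, [set` T] `<=` A &
  forall x, x \in S -> A x -> x = 0].
(* the empty set is admitted as the union of the empty chain *)
have [|A [Agood Amax]] := @Zorn_bigcup V [set A | (exists x, A x) -> good A].
  move=> F Fgood Ftot [x0 [A0 FA0 A0x0]].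
  have [[A00 _] TA0 _] : good A0 by apply: Fgood => //; exists x0.
  split=> [|x Tx|x Sx [A FA Ax]]; last first.
  - by have [|_ _] := Fgood _ FA; [exists x|apply].
  - by exists A0 => //; exact: TA0.
  split=> [|a x y [A FA Ax] [B FB By]]; first by exists A0.
  have [AB|BA] := Ftot _ _ FA FB.
    exists B => //; have [|[_ BZD] _ _] := Fgood _ FB; first by exists y.
    by apply: BZD => //; exact: AB.
  exists A => //; have [|[_ AZD] _ _] := Fgood _ FA; first by exists x.
  by apply: AZD => //; exact: BA.
have submod_good (T' : submodClosed V) : {subset T <= T'} ->
    disjoint_submod S T' -> good [set` T'].
  move=> TT' disjST'; split=> //; split=> [|a x y]; first exact: rpred0.
  by move=> T'x T'y; rewrite /= rpredD // rpredZ.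
have Aex : exists x, A x.
  apply: contrapT => /forallNP A0; apply: (Amax [set` T]).
    split=> [x /A0 //|T0]; apply: (A0 0); apply: T0; exact: rpred0.
  by move=> _; exact: submod_good.
have [cA TA disjSA] := Agood Aex.
exists (mk_submod cA); split=> [x Tx|x Sx /in_mk_submod|T'' AT'' disjST'' x T''x].
- exact/in_mk_submod/TA.
- exact: disjSA.
apply/in_mk_submod; apply: contrapT => nAx; apply: (Amax [set` T'']).
  split=> [y Ay|T''A]; first exact/AT''/in_mk_submod.
  exact/nAx/T''A.
move=> _; apply: submod_good => // y Ty; exact/AT''/in_mk_submod/TA.
Qed.

Definition idempotent_map (V : lmodType R) (e : {linear V -> V}) :=
  forall x, e (e x) = e x.

(** In an injective module disjoint submodules are separated by a projection:
    enlarge them to [S'] and [T'], each maximal among the submodules disjoint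
    from the other.  A map [p] extending the projection of [S' + T'] onto [S']
    has kernel [T'], and its image is disjoint from [T'], hence equals [S']. *)
Lemma injective_split (M H : lmodType R) (S T : submodClosed H) :
    injective_in_sigma M H -> disjoint_submod S T ->
  exists p : {linear H -> H}, [/\ idempotent_map p,
    forall x, x \in S -> p x = x & forall x, x \in T -> p x = 0].
Proof.
move=> [sigH injH] /complement_ex[T' [TT' disjST' T'max]].
have disjT'S : disjoint_submod T' S by move=> x T'x Sx; exact: disjST'.
have [S' [SS' disjT'S' S'max]] := complement_ex disjT'S.
pose A : lmodType R := (submod_type S' * submod_type T')%type.
have lf : linear (fun z : A => submod_val z.1 + submod_val z.2).
  move=> a z w; rewrite (@submod_val_linear R H S' a) (@submod_val_linear R H T' a).
  by rewrite scalerDr addrACA.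
have lh : linear (fun z : A => submod_val z.1).
  by move=> a z w; rewrite (@submod_val_linear R H S' a).
pose f := mk_linear lf; pose h := mk_linear lh.
have fI : injective f.
  apply: lin_inj => -[s t]; rewrite /f /= => /eqP; rewrite addr_eq0 => /eqP st.
  have s0 : submod_val s = 0.
    apply: disjT'S'; last exact: submod_val_in.
    by rewrite st -scaleN1r; apply: rpredZ; exact: submod_val_in.
  have t0 : submod_val t = 0 by apply: oppr_inj; rewrite -st s0 oppr0.
  by congr pair; apply: val_inj; rewrite ?[LHS]s0 ?[LHS]t0.
have [p pE] := injH _ _ f (sigma_inj sigH fI) sigH fI h.
have pST s t : s \in S' -> t \in T' -> p (s + t) = s.
  by move=> S's T't; exact: (pE (exist _ s S's, exist _ t T't)).
have pS s : s \in S' -> p s = s.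
  by move=> S's; rewrite -[X in p X]addr0 pST // rpred0.
have pT t : t \in T' -> p t = 0.
  by move=> T't; rewrite -[X in p X]add0r pST // rpred0.
have preT' y : p y \in T' -> p y = 0.
  move=> T'py; apply: (pT); apply: (T'max (preimage_submod p T')).
  - by move=> t T't; apply/in_preimage_submod; rewrite pT // rpred0.
  - move=> s Ss /in_preimage_submod; rewrite pS; last exact: SS'.
    exact: disjST'.
  exact/in_preimage_submod.
have imS' y : p y \in S'.
  apply: (S'max (image_submod p full_submod)).
  - move=> s S's; apply/in_image_submod; exists s; last exact: pS.
    exact: full_submodT.
  - move=> x T'x /in_image_submod[z _ zx]; rewrite -zx.
    by apply: preT'; rewrite zx.
  by apply/in_image_submod; exists y => //; exact: full_submodT.
exists p; split=> [x|x /SS'|x /TT']; [exact/pS/imS'|exact: pS|exact: pT].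
Qed.

Lemma injective_retract (M H E : lmodType R) (a : {linear H -> E})
    (b : {linear E -> H}) :
  cancel b a -> injective_in_sigma M H -> injective_in_sigma M E.
Proof.
move=> bK [sigH injH]; split; first exact: sigma_inj sigH (can_inj bK).
move=> A B f sigA sigB fI h; have [k kE] := injH _ _ f sigA sigB fI (b \o h).
by exists (a \o k) => x; rewrite -[RHS]bK -[b _]kE.
Qed.

(** Uniform injective modules that contain isomorphic nonzero submodules are
    both injective hulls of these, hence isomorphic. *)
Lemma uniform_injective_iso (M E E' A : lmodType R)
    (f : {linear A -> E}) (g : {linear A -> E'}) (a0 : A) :
    injective_in_sigma M E -> injective_in_sigma M E' ->
    uniform_submod (@full_submod R E) -> uniform_submod (@full_submod R E') ->
    injective f -> injective g -> a0 != 0 ->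
  exists (phi : {linear E -> E'}) (psi : {linear E' -> E}),
    cancel phi psi /\ cancel psi phi.
Proof.
move=> [sE iE] [sE' iE'] [_ uE] [_ uE'] fI gI a0_neq0.
have [phi phiE] := iE' _ _ f (sigma_inj sE fI) sE fI g.
have fa0 : f a0 != 0 by apply: contraNneq a0_neq0 => /(lin_inj0 fI) ->.
have phiI : injective phi.
  apply: lin_inj => x phix0; apply/eqP; apply: contraT => x0.
  have [a [b [ab]]] := uE _ _ (full_submodT x) (full_submodT (f a0)) x0 fa0.
  suff /(lin_inj0 gI) ba0 : g (b *: a0) = 0.
    by rewrite ab -linearZ /= ba0 linear0 eqxx.
  by rewrite -[LHS]phiE /= linearZ /= -ab linearZ /= phix0 scaler0.
have [psi psiE] := iE _ _ phi sE sE' phiI idfun.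
exists phi, psi; split=> [x|y]; first exact: psiE.
apply/eqP; rewrite -subr_eq0; apply: contraT => z0.
have pfa0 : phi (f a0) != 0 by apply: contraNneq fa0 => /(lin_inj0 phiI) ->.
have [a [b [ab]]] := uE' _ _ (full_submodT _) (full_submodT _) z0 pfa0.
suff bfa0 : b *: f a0 = 0 by rewrite ab -linearZ /= bfa0 linear0 eqxx.
rewrite -[f a0]psiE /= -linearZ /= -ab linearZ /= linearB /=.
by rewrite [psi (phi _)]psiE subrr scaler0.
Qed.

(** For idempotents: [e'] has a smaller image and a larger kernel than [e]. *)
Definition idem_le (V : lmodType R) (e' e : {linear V -> V}) :=
  forall x, e' (e x) = e' x /\ e (e' x) = e' x.

Lemma idem_le_trans (V : lmodType R) (e1 e2 e3 : {linear V -> V}) :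
  idem_le e1 e2 -> idem_le e2 e3 -> idem_le e1 e3.
Proof.
move=> l12 l23 x; split; first by rewrite -(l12 (e3 x)).1 (l23 x).1 (l12 x).1.
by rewrite -(l12 x).2 (l23 _).2.
Qed.

(** Finite uniform dimension forbids infinite descending chains: the
    differences of consecutive idempotents would project onto an infinite
    independent family. *)
Lemma idem_minimal (H : lmodType R) (F : set {linear H -> H}) e0 :
    finite_uniform_dimension H ->
    (forall e, F e -> idempotent_map e) -> F e0 ->
  exists2 e, F e & forall e', F e' -> idem_le e' e -> e' =1 e.
Proof.
move=> fudH Fidem Fe0; apply: contrapT => noMin.
have step (e : {e | F e}) : exists e' : {e | F e},
    idem_le (sval e') (sval e) /\ exists x, sval e' x != sval e x.
  case: e => e Fe /=; apply: contra_notP noMin => noe'; exists e => // e' Fe' le.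
  move=> x; apply: contra_notP noe' => /eqP e'x.
  by exists (exist _ e' Fe'); split=> //; exists x.
have [next nextP] := choice step.
pose e n := sval (iter n next (exist _ e0 Fe0)).
have idem_e n : idempotent_map (e n) by exact/Fidem/svalP.
have le_e m n : (m <= n)%N -> idem_le (e n) (e m).
  elim: n => [|n IHn]; first by rewrite leqn0 => /eqP -> x; split; exact: idem_e.
  rewrite leq_eqVlt => /predU1P[-> x|]; first by split; exact: idem_e.
  by rewrite ltnS => /IHn; apply: idem_le_trans; exact: (nextP (iter n next _)).1.
pose d n : {linear H -> H} := e n \- e n.+1.
have dE n x : d n x = e n x - e n.+1 x by [].
have dd i j x : i != j -> d i (d j x) = 0.
  rewrite neq_ltn => /orP[ij|ji].
    have fix_d k : (k <= j)%N -> e k (d j x) = d j x.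
      move=> kj; rewrite !dE linearB /=.
      by rewrite (le_e _ _ kj x).2 (le_e _ _ (leqW kj) x).2.
    by rewrite [d i _]dE !fix_d ?subrr // ltnW.
  have kill_d k : (j < k)%N -> e k (d j x) = 0.
    move=> jk; rewrite !dE linearB /=.
    by rewrite (le_e _ _ jk x).1 (le_e _ _ (ltnW jk) x).1 subrr.
  by rewrite [d i _]dE !kill_d ?subrr // ltnW.
have d_idem n x : d n (d n x) = d n x.
  rewrite !dE !linearB /= !idem_e (le_e _ _ (leqnSn n) x).1.
  by rewrite (le_e _ _ (leqnSn n) x).2 subrr addr0.
apply: fudH; exists (fun n => image_submod (d n) full_submod); split=> [n|n x].
  have [x xn] := (nextP (iter n next (exist _ e0 Fe0))).2.
  exists (d n x); last by rewrite dE subr_eq0 eq_sym.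
  by apply/in_image_submod; exists x => //; exact: full_submodT.
move=> /in_image_submod[y _ <-] dsum_y; rewrite -d_idem.
apply/in_zero_submod/in_preimage_submod; move: dsum_y; apply: sum_submod_le.
move=> _ [j /eqP jn <-] _ /in_image_submod[z _ <-].
by apply/in_preimage_submod/in_zero_submod; rewrite dd // eq_sym.
Qed.

Definition uniform_map (V : lmodType R) (u : {linear V -> V}) :=
  uniform_submod (image_submod u full_submod).

Lemma in_image_idem (V : lmodType R) (e : {linear V -> V}) x :
  idempotent_map e -> (x \in image_submod e full_submod) <-> e x = x.
Proof.
move=> eid; split=> [/in_image_submod[y _ <-]|ex]; first exact: eid.
by apply/in_image_submod; exists x => //; exact: full_submodT.
Qed.

Section InjectiveDecomposition.
Variables (M H : lmodType R).
Hypotheses (injH : injective_in_sigma M H) (fudH : finite_uniform_dimension H).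

(** The projection [p] separates two elements of the image of [e] whose cyclic
    submodules are disjoint; it respects the kernel of [e], and [e \o p] takes
    its image back into that of [e]. *)
Lemma idem_split (e : {linear H -> H}) x0 :
    idempotent_map e -> e x0 != 0 -> ~ uniform_map e ->
  exists e' : {linear H -> H}, [/\ idempotent_map e', idem_le e' e,
    exists x, e' x != 0 & exists x, e' x != e x].
Proof.
move=> eid ex0 nunif.
have [x [y [ex ey x0' y0 xy]]] : exists x y, [/\ e x = x, e y = y, x != 0, y != 0 &
    forall a b, a *: x = b *: y -> a *: x = 0].
  apply: contrapT => noxy; apply: nunif; split.
    by exists (e x0) => //; exact/in_image_idem.
  move=> x y /(in_image_idem _ eid) ex /(in_image_idem _ eid) ey x_neq0 y_neq0.
  apply: contrapT => noab; apply: noxy; exists x, y; split=> // a b ab.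
  by apply: contra_notP noab => /eqP ax0; exists a, b.
(* the second submodule must contain the kernel of [e] besides [y], so that
   [p \o e = p] *)
have [|p [pid px pT]] := injective_split injH
    (S := cyclic_submod x) (T := preimage_submod e (cyclic_submod y)).
  move=> _ /in_cyclic_submod[a ->] /in_preimage_submod/in_cyclic_submod[b].
  by rewrite linearZ /= ex; exact: xy.
have pe z : p (e z) = p z.
  apply/eqP; rewrite -subr_eq0 -linearB; apply/eqP/pT/in_preimage_submod.
  by rewrite linearB eid subrr rpred0.
exists (e \o p); split=> [z|z||] /=; first by rewrite pe pid.
- by rewrite pe eid.
- by exists x; rewrite px ?ex //; exact: cyclic_submod_id.
exists y; rewrite pT ?linear0 ?ey 1?eq_sym //.
by apply/in_preimage_submod; rewrite ey; exact: cyclic_submod_id.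
Qed.

(** A nonzero idempotent that is minimal below [e] cannot be split any more. *)
Lemma uniform_below (e : {linear H -> H}) x0 :
    idempotent_map e -> e x0 != 0 ->
  exists u : {linear H -> H},
    [/\ idempotent_map u, idem_le u e & uniform_map u].
Proof.
move=> eid ex0.
have [||u [uid ule [x ux0]] umin] := @idem_minimal H
    [set u | [/\ idempotent_map u, idem_le u e & exists x, u x != 0]] e fudH.
- by move=> u [].
- by split=> [//|x|]; [split; exact: eid|exists x0].
exists u; split=> //; apply: contrapT => nunif.
have [e' [e'id e'u e'0 [y /eqP]]] := idem_split uid ux0 nunif.
by apply; apply: umin => //; split=> //; exact: idem_le_trans ule.
Qed.

(** Let [e] project onto a complement of a finite sum of uniform submodules.  If
    [e] is nonzero, a uniform summand of its image can be moved to the sum, so a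
    minimal such [e] is zero. *)
Lemma uniform_decomposition : exists (m : nat) (u : nat -> {linear H -> H}),
  [/\ forall j, (j < m)%N -> idempotent_map (u j) /\ uniform_map (u j),
      forall i j x, (i < m)%N -> (j < m)%N -> i != j -> u i (u j x) = 0 &
      forall x, x = \sum_(j < m) u j x].
Proof.
pose compl (e : {linear H -> H}) (m : nat) (u : nat -> {linear H -> H}) :=
  [/\ forall j, (j < m)%N -> idempotent_map (u j) /\ uniform_map (u j),
      forall i j x, (i < m)%N -> (j < m)%N -> i != j -> u i (u j x) = 0,
      forall j x, (j < m)%N -> u j (e x) = 0 /\ e (u j x) = 0 &
      forall x, x = e x + \sum_(j < m) u j x].
have [||e [eid [m [u [uunif uu ue usum]]]] emin] := @idem_minimal H
    [set e | idempotent_map e /\ exists m u, compl e m u] idfun fudH.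
- by move=> e [].
- split=> //; exists 0, (fun _ => idfun); split=> // x.
  by rewrite big_ord0 addr0.
suff e0 x : e x = 0.
  by exists m, u; split=> // x; rewrite {1}(usum x) e0 add0r.
apply/eqP; apply: contraT => /(uniform_below eid)[v [vid ve vunif]].
have [[_ /in_image_submod[y _ <-] vy0] _] := vunif.
suff /(_ y)/eqP : e \- v =1 e.
  by rewrite -subr_eq0 /= addrAC subrr add0r oppr_eq0 (negPf vy0).
have vu j z : (j < m)%N -> v (u j z) = 0.
  by move=> jm; rewrite -(ve _).1 (ue _ _ jm).2 linear0.
have uv j z : (j < m)%N -> u j (v z) = 0.
  by move=> jm; rewrite -(ve _).2 (ue _ _ jm).1.
apply: (emin (e \- v)); last first.
  move=> z /=; rewrite linearB /= !eid (ve z).1 (ve z).2; split=> //.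
split=> [z /=|]; first by rewrite !linearB /= eid vid (ve z).1 (ve z).2 subrr addr0.
exists m.+1, (fun j => if (j < m)%N then u j else v); split=> [j|i j z|j z|z].
- by rewrite ltnS => _; case: ifP => // jm; exact: uunif.
- rewrite !ltnS => im jm ij; case: ifP => im'; case: ifP => jm'.
  + exact: uu.
  + exact: uv.
  + exact: vu.
  case/eqP: ij; apply: (@eq_trans _ _ m); apply/eqP.
    by rewrite eqn_leq im leqNgt im'.
  by rewrite eqn_leq jm leqNgt jm'.
- move=> _ /=; case: ifP => jm; rewrite linearB /=.
    by rewrite (ue _ _ jm).1 (ue _ _ jm).2 uv // vu // !subr0.
  by rewrite vid (ve z).1 (ve z).2 !subrr.
rewrite big_ord_recr /= ltnn (eq_bigr (fun j : 'I_m => u j z)).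
  by rewrite addrA addrAC subrK; exact: usum.
by move=> j _; rewrite /= ltn_ord.
Qed.

End InjectiveDecomposition.

End Splitting.

(** * The injective hull *)

Section Hull.
Variable R : pzRingType.

Lemma uniform_preimage (U V : lmodType R) (i : {linear U -> V})
    (S : submodClosed V) : injective i ->
    nonzero_submod (preimage_submod i S) -> uniform_submod S ->
  uniform_submod (preimage_submod i S).
Proof.
move=> iI pre0 [_ unifS]; split=> // x y /in_preimage_submod Sx
  /in_preimage_submod Sy x0 y0.
have i0 z : z != 0 -> i z != 0 by apply: contraNneq => /(lin_inj0 iI) ->.
have [a [b [ab abx]]] := unifS _ _ Sx Sy (i0 _ x0) (i0 _ y0); exists a, b.
split; first by apply: iI; rewrite !linearZ.
by apply: contraNneq abx => ax0; rewrite -linearZ /= ax0 linear0.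
Qed.

Lemma uniform_submod_type (V : lmodType R) (S : submodClosed V) :
  uniform_submod S -> uniform_submod (@full_submod R (submod_type S)).
Proof.
move=> unifS; have [[x Sx x0] _] := unifS.
have full0 : nonzero_submod (@full_submod R (submod_type S)).
  exists (exist _ x Sx); first exact: full_submodT.
  by apply: contraNneq x0 => /(congr1 (submod_incl S)) /= xS; apply/eqP.
apply: uniform_submod_le (uniform_preimage (@submod_incl_inj R V S) _ unifS) => //.
  by move=> z _; apply/in_preimage_submod; exact: submod_val_in.
case: full0 => z _ z0; exists z => //.
by apply/in_preimage_submod; exact: submod_val_in.
Qed.

Lemma uniform_submod_module (V : lmodType R) :
  uniform_submod (@full_submod R V) -> uniform_module V.
Proof.
case=> [[x _ x0] unifV]; split; first by exists x.
move=> S T [s Ss s0] [t Tt t0].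
have [a [b [ab as0]]] := unifV _ _ (full_submodT s) (full_submodT t) s0 t0.
by exists (a *: s); split=> //; [exact: rpredZ|rewrite ab rpredZ].
Qed.

Variables (M H : lmodType R) (eM : {linear M -> H}).
Hypothesis hullM : injective_hull eM.

Let eM_inj : injective eM. Proof. by have [] := hullM. Qed.

Lemma hull_preimage_nonzero (S : submodClosed H) :
  nonzero_submod S -> nonzero_submod (preimage_submod eM S).
Proof.
have [_ _ essM] := hullM => /essM[m m0 Sm]; exists m => //.
exact/in_preimage_submod.
Qed.

(** Nonzero submodules of the hull meet [M] in nonzero submodules. *)
Lemma hull_finite_uniform_dimension :
  finite_uniform_dimension M -> finite_uniform_dimension H.
Proof.
apply: contra_not => -[N [N0 indN]].
exists (fun n => preimage_submod eM (N n)); split=> [n|n x].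
  exact: hull_preimage_nonzero.
move=> /in_preimage_submod Nx sum_x; apply: lin_inj0 eM_inj _; apply: indN Nx _.
apply/in_preimage_submod; move: x sum_x; apply: sum_submod_le => _ [j jn <-] x.
move=> /in_preimage_submod Njx; apply/in_preimage_submod.
by apply: sum_submod_ge Njx; exists j.
Qed.

(** Here [E] plays the role of a submodule of the hull, embedded by [b].  As [L]
    lies in [E], its annihilator is associated to [E]; witnesses for two
    associated primes meet, since [E] is uniform, and so the primes agree. *)
Lemma Ass_uniform (E : lmodType R) (b : {linear E -> H}) (L K : submodClosed M) :
    injective b -> uniform_submod (@full_submod R E) -> prime_in K ->
    ann_stable L K -> (forall x, x \in L -> exists y, eM x = b y) ->
  Ass M E = [set K].
Proof.
move=> bI [_ unifE] primeK [[x0 Lx0 x00] LK] Lb.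
pose LE := preimage_submod b (image_submod eM L).
have inLE y : y \in LE -> exists2 x, x \in L & b y = eM x.
  by move=> /in_preimage_submod/in_image_submod[x Lx <-]; exists x.
have LE0 : nonzero_submod LE.
  have [y bxy] := Lb _ Lx0; exists y.
    by apply/in_preimage_submod; rewrite -bxy; apply/in_image_submod; exists x0.
  by apply: contraNneq x00 => y0; apply/eqP/(lin_inj0 eM_inj);
    rewrite bxy y0 linear0.
have LEK : ann_stable LE K.
  split=> // L' L'LE [y L'y y0].
  pose T := preimage_submod eM (image_submod b L').
  have inT x : x \in T -> exists2 z, z \in L' & eM x = b z.
    by move=> /in_preimage_submod/in_image_submod[z L'z <-]; exists z.
  have L'T z : z \in L' -> exists2 x, x \in T & b z = eM x.
    move=> L'z; have [x Lx bz] := inLE _ (L'LE _ L'z); exists x => //.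
    by apply/in_preimage_submod; rewrite -bz; apply/in_image_submod; exists z.
  rewrite (annihilator_transfer M bI eM_inj L'T inT); apply: LK.
    move=> x /inT[z L'z xz]; have [w Lw zw] := inLE _ (L'LE _ L'z).
    by rewrite (eM_inj (etrans xz zw)).
  have [x Tx yx] := L'T _ L'y; exists x => //.
  by apply: contraNneq y0 => x0'; apply/eqP/(lin_inj0 bI); rewrite yx x0' linear0.
have [fiK properK _] := primeK.
apply/seteqP; split=> [K' [_ [_ _ [L1 [[x L1x xn0] L1K]]]]|_ ->]; last first.
  by split=> //; split=> //; exists LE.
case: LE0 => y LEy yn0.
have [a [c [ac ax0]]] :=
  unifE _ _ (full_submodT x) (full_submodT y) xn0 yn0.
have C0 : nonzero_submod (cyclic_submod (a *: x)).
  by exists (a *: x) => //; exact: cyclic_submod_id.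
rewrite /= -(L1K _ _ C0); last first.
  by move=> _ /in_cyclic_submod[r ->]; rewrite !rpredZ.
by apply: LEK.2 => // _ /in_cyclic_submod[r ->]; rewrite ac !rpredZ.
Qed.

(** Here [u j] are the projections onto the uniform summands of the hull and
    [L j] are submodules of [M] lying in these.  Every nonzero element of [M]
    has a multiple [d] all of whose projections lie in the [L j]; hence the
    intersection [A] of the annihilators of the [L j] kills the submodule
    generated by [d].  If [d] is in [A], this contradicts semiprimeness. *)
Lemma inter_annihilators (m : nat) (u : nat -> {linear H -> H})
    (L : nat -> submodClosed M) x :
    projective_in_sigma M -> semiprime_module M ->
    (forall z, z = \sum_(j < m) u j z) ->
    (forall j, (j < m)%N -> uniform_map (u j)) ->
    (forall j y, (j < m)%N -> y \in L j ->
       eM y \in image_submod (u j) full_submod) ->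
    (forall j, (j < m)%N -> nonzero_submod (L j)) ->
    (forall j, (j < m)%N -> x \in annihilator M (submod_type (L j))) ->
  x = 0.
Proof.
move=> projM spM usum uunif Lu L0 xL; apply/eqP; apply: contraT => x0.
have [r rx0 rxL] : exists2 r, r *: x != 0 & forall j, (j < m)%N ->
    u j (eM (r *: x)) \in image_submod (eM) (L j).
  have : (m <= m)%N by [].
  elim: {-2}m => [_|k IHk km]; first by exists 1; rewrite ?scale1r.
  have [r rx0 rxL] := IHk (ltnW km).
  have [urx|urx] := eqVneq (u k (eM (r *: x))) 0.
    exists r => // j; rewrite ltnS leq_eqVlt => /predU1P[->|]; last exact: rxL.
    by rewrite urx rpred0.
  have [l Ll l0] := L0 _ km.
  have el0 : eM l != 0 by apply: contraNneq l0 => /(lin_inj0 eM_inj) ->.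
  have urxU : u k (eM (r *: x)) \in image_submod (u k) full_submod.
    by apply/in_image_submod; exists (eM (r *: x)) => //; exact: full_submodT.
  have [a [b [ab au0]]] := (uunif _ km).2 _ _ urxU (Lu _ _ km Ll) urx el0.
  have uaE j : u j (eM ((a * r) *: x)) = a *: u j (eM (r *: x)).
    by rewrite -scalerA !linearZ.
  exists (a * r).
    by apply: contraNneq au0 => ar0; rewrite -uaE ar0 !linear0.
  move=> j; rewrite uaE ltnS leq_eqVlt => /predU1P[->|jk].
    by rewrite ab rpredZ //; apply/in_image_submod; exists l.
  by rewrite rpredZ // rxL.
have [|f [fD [_ /in_cyclic_submod[c ->] /eqP]]] :=
  semiprime_ex projM spM (L := cyclic_submod (r *: x)).
  by exists (r *: x) => //; exact: cyclic_submod_id.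
case; apply: (lin_inj0 eM_inj); rewrite [LHS]usum; apply: big1 => j _.
have : c *: (r *: x) \in annihilator M (submod_type (L j)).
  by rewrite !rpredZ // xL.
move=> /(annihilatorP _ _ eM_inj)/(_ (u j \o (eM \o f))); apply=> z /=.
have /in_cyclic_submod[a ->] := fD z.
have /in_image_submod[l Ll ll] := rxL j (ltn_ord j).
by exists (a *: l); rewrite ?rpredZ // [RHS]linearZ /= ll !linearZ.
Qed.

End Hull.

Section Assembly.
Variable R : pzRingType.

Lemma in_fin_supp (I : finType) (V : I -> lmodType R) (b : dirprod V) :
  b \in fin_supp V.
Proof. by apply/(in_mk_submod (fin_supp_subproof _)); exact: finite_finset. Qed.

(** A finite direct sum is also a direct product. *)
Lemma dsum_pairing (X : lmodType R) (I : finType) (V : I -> lmodType R)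
    (f : forall i, {linear X -> V i}) :
  exists F : {linear X -> dsum V}, forall x i, submod_val (F x) i = f i x.
Proof.
pose F x : dsum V := exist (fun b => b \in fin_supp V) _
  (in_fin_supp (fun i => f i x : V i)).
have lF : linear F.
  move=> a x y; apply: val_inj; apply: functional_extensionality_dep => i.
  exact: linearP.
by exists (mk_linear lF).
Qed.

(** The hypothesis on [u j], [a] and [b] says that [E (c j)] is isomorphic to the
    image of [u j], without mentioning that image as a module.  The [i]-th block
    is then indexed by the [j] with [c j = i]. *)
Lemma group_summands (H : lmodType R) (n m : nat) (c : 'I_m -> 'I_n)
    (u : 'I_m -> {linear H -> H}) (E : 'I_n -> lmodType R) :
    (forall x, x = \sum_j u j x) ->
    (forall i j x, i != j -> u i (u j x) = 0) ->
    (forall j, exists (a : {linear H -> E (c j)}) (b : {linear E (c j) -> H}),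
       cancel b a /\ forall x, b (a x) = u j x) ->
  isomorphic H (dsum (fun i => dsum (fun _ : 'I_#|[set j | c j == i]%SET| => E i))).
Proof.
move=> usum uu abex; pose C i := [set j | c j == i]%SET.
have ab_c j i : c j = i -> exists ab : {linear H -> E i} * {linear E i -> H},
    cancel ab.2 ab.1 /\ forall x, ab.2 (ab.1 x) = u j x.
  by move=> <-; have [a [b [bK ba]]] := abex j; exists (a, b).
have ab_ex i (s : 'I_#|C i|) : exists ab : {linear H -> E i} * {linear E i -> H},
    cancel ab.2 ab.1 /\ forall x, ab.2 (ab.1 x) = u (enum_val s) x.
  by apply: ab_c; have := enum_valP s; rewrite inE => /eqP.
pose a i s := (sval (cid (ab_ex i s))).1.
pose b i s := (sval (cid (ab_ex i s))).2.
have bK i s : cancel (b i s) (a i s) := (svalP (cid (ab_ex i s))).1.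
have ba i s x : b i s (a i s x) = u (enum_val s) x :=
  (svalP (cid (ab_ex i s))).2 x.
have ab0 i s i' s' z : enum_val s != enum_val s' -> a i s (b i' s' z) = 0.
  by move=> ss'; rewrite -[LHS](bK i s) -(bK i' s' z) !ba uu // linear0.
have [f fE] : exists f : forall i, {linear H -> dsum (fun _ : 'I_#|C i| => E i)},
    forall i x s, submod_val (f i x) s = a i s x.
  pose fex i := cid (@dsum_pairing H _ (fun _ : 'I_#|C i| => E i) (a i)).
  by exists (fun i => sval (fex i)) => i; exact: svalP (fex i).
have [F FE] := dsum_pairing f; exists F; apply: bij_inj_surj.
  apply: lin_inj => x Fx0; rewrite (usum x); apply: big1 => j _.
  have jC : j \in C (c j) by rewrite inE.
  rewrite -(enum_rankK_in jC jC) -ba -fE -FE Fx0.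
  by rewrite [X in b _ _ X](_ : _ = 0) // linear0.
move=> y; exists (\sum_i \sum_s b i s (submod_val (submod_val y i) s)).
apply: val_inj; apply: functional_extensionality_dep => i; rewrite [LHS]FE.
apply: val_inj; apply: functional_extensionality_dep => s; rewrite [LHS]fE.
rewrite linear_sum (bigD1 i) //= linear_sum (bigD1 s) //= bK.
rewrite !big1 ?addr0 // => [i' ii'|s' ss'].
  rewrite linear_sum big1 // => s' _; apply: ab0.
  apply: contraNneq ii' => ss'.
  have := enum_valP s; have := enum_valP s'.
  by rewrite -ss' !inE => /eqP -> /eqP ->.
by apply: ab0; rewrite (inj_eq enum_val_inj) eq_sym.
Qed.

End Assembly.

Theorem theorem2p20 (R : pzRingType) (M : lmodType R)
    (projM : projective_in_sigma M) (spM : semiprime_module M)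
    (goldieM : goldie_module M)
    (n : nat) (P : 'I_n -> submodClosed M)
    (injP : injective P)
    (minP : range P = [set Q | minimal_prime_in Q])
    (N : 'I_n -> submodClosed M)
    (defN : forall i, N i = right_annihilator (P i))
    (Mhat : lmodType R) (eM : {linear M -> Mhat})
    (hullM : injective_hull eM) :
  exists (E : 'I_n -> lmodType R) (k : 'I_n -> nat),
    [/\ (forall i, uniform_module (E i) /\ injective_in_sigma M (E i)),
        (forall i, (0 < k i)%N),
        isomorphic Mhat (dsum (fun i => dsum (fun _ : 'I_(k i) => E i))) &
        (forall i, Ass M (E i) = [set P i])].
Proof.
have [accM fudM] := goldieM; have [injH eM_inj _] := hullM.
have fudH := hull_finite_uniform_dimension hullM fudM.
have [m [u [u_unif uu usum]]] := uniform_decomposition injH fudH.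
pose U j := image_submod (u j) full_submod.
have VU j : (j < m)%N -> uniform_submod (preimage_submod eM (U j)).
  move=> /u_unif[_ Uj]; apply: (uniform_preimage eM_inj) => //.
  by apply: (hull_preimage_nonzero hullM); case: Uj.
(* the values of [LK] at [j >= m] are dummies *)
have /choice[LK LKP] j : exists LK : submodClosed M * submodClosed M,
    (j < m)%N -> {subset LK.1 <= preimage_submod eM (U j)} /\
                 ann_stable LK.1 LK.2.
  case: (ltnP j m) => [jm|_]; last by exists (zero_submod, zero_submod).
  by have [L [K LK]] := ann_stable_ex accM (VU j jm).1; exists (L, K).
pose L j := (LK j).1; pose K j := (LK j).2.
have LU j x : (j < m)%N -> x \in L j -> eM x \in U j.
  by move=> jm Lx; apply/in_preimage_submod/(LKP _ jm).1.
have stL j : (j < m)%N -> ann_stable (L j) (K j) by move=> /LKP[].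
have L0 j : (j < m)%N -> nonzero_submod (L j) by move=> /stL[].
have L_unif j : (j < m)%N -> uniform_submod (L j).
  move=> jm; exact: uniform_submod_le (LKP j jm).1 (L0 j jm) (VU j jm).
(* [c j] is the index of the minimal prime associated to [U j] *)
have /choice[c cP] (j : 'I_m) : exists i, P i = K j.
  have : range P (K j).
    by rewrite minP; exact: (ann_stable_minimal projM spM (stL j (ltn_ord j))).
  by case=> i _ PiK; exists i.
(* every minimal prime occurs, so [j0 i] can serve to define [E i] *)
have /choice[j0 j0P] i : exists j, c j = i.
  have [primePi minPi] : minimal_prime_in (P i).
    by have : range P (P i); [exists i|rewrite minP].
  have [j /stL/ann_stable_fi //|x xK|j jm KjP] :=
    @prime_finite_inter _ _ (P i) K m primePi.
    suff -> : x = 0 by exact: rpred0.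
    apply: (inter_annihilators hullM projM spM usum (L := L)) => //.
      by move=> j /u_unif[].
    by move=> j jm; rewrite (ann_stableE (stL j jm)); exact: xK.
  exists (Ordinal jm); apply: injP; rewrite cP; apply: minPi => //.
  exact: (ann_stable_prime projM spM (stL j jm)).
have U_inj (j : 'I_m) : injective_in_sigma M (submod_type (U j)).
  have [uid _] := u_unif j (ltn_ord j).
  have uU x : u j x \in U j by apply/(in_image_idem _ uid).
  apply: (injective_retract (a := corestr uU) (b := submod_incl (U j))) injH.
  move=> x; apply: val_inj; apply/(in_image_idem _ uid); exact: submod_val_in.
have UT_unif (j : 'I_m) : uniform_submod (@full_submod R (submod_type (U j))).
  by apply: uniform_submod_type; have [_] := u_unif j (ltn_ord j).
pose E i : lmodType R := submod_type (U (j0 i)).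
have U_iso (j : 'I_m) : exists (a : {linear Mhat -> E (c j)})
    (b : {linear E (c j) -> Mhat}), cancel b a /\ forall x, b (a x) = u j x.
  set j' := j0 (c j).
  have KK : K j' = K j by rewrite -!cP j0P.
  have stL' : ann_stable (L j') (K j) by rewrite -KK; exact: stL.
  have [g gL' gI] := uniform_embed projM spM accM (L_unif j (ltn_ord j))
    (stL j (ltn_ord j)) stL'.
  have f1U (x : submod_type (L j)) : (eM \o submod_incl (L j)) x \in U j.
    apply: (LU j _ (ltn_ord j)); exact: submod_val_in.
  have f2U (x : submod_type (L j)) :
      (eM \o (g \o submod_incl (L j))) x \in U j'.
    apply: (LU j' _ (ltn_ord j')); exact: gL'.
  have [l Ll l0] := L0 j (ltn_ord j).
  (* [L j] embeds in [U j] by inclusion and in [U j'] through [g] *)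
  have [|||phi [psi [phiK psiK]]] := uniform_injective_iso
    (f := corestr f1U) (g := corestr f2U) (a0 := exist _ l Ll)
    (U_inj j) (U_inj j') (UT_unif j) (UT_unif j').
  - apply: lin_inj => x /(congr1 (submod_incl (U j))) /=.
    by move=> /(lin_inj0 eM_inj) x0; exact: val_inj.
  - apply: lin_inj => x /(congr1 (submod_incl (U j'))) /=.
    move=> /(lin_inj0 eM_inj)/gI x0; apply: val_inj; apply: x0.
    exact: submod_val_in.
  - by apply: contraNneq l0 => /(congr1 (submod_incl (L j))) /= l0; apply/eqP.
  have [uid _] := u_unif j (ltn_ord j).
  have uU x : u j x \in U j by apply/(in_image_idem _ uid).
  exists (phi \o corestr uU), (submod_incl (U j) \o psi); split=> x /=.
    rewrite -[RHS]psiK; congr (phi _); apply: val_inj.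
    apply/(in_image_idem _ uid); exact: submod_val_in.
  by rewrite phiK.
exists E, (fun i => #|[set j | c j == i]%SET|); split=> [i|i||i].
- by split; [exact: uniform_submod_module (UT_unif _)|exact: U_inj].
- by apply/card_gt0P; exists (j0 i); rewrite inE j0P.
- have uu' (i j : 'I_m) x : i != j -> u i (u j x) = 0 by move=> ij; exact: uu.
  exact: group_summands usum uu' U_iso.
- have jm := ltn_ord (j0 i).
  have <- : K (j0 i) = P i by rewrite -cP j0P.
  apply: (Ass_uniform hullM (@submod_incl_inj _ _ (U (j0 i))) (UT_unif _)
    (ann_stable_prime projM spM (stL _ jm)) (stL _ jm)) => x /(LU _ _ jm) Ux.
  by exists (exist (fun z => z \in U (j0 i)) _ Ux).
Qed.
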